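(* Let $\mathcal{D}\subset\mathbb{R}^d$, let $l=(l(t),\,t\ge 0)$ be a Lévy process with Lévy triplet $(\gamma,b,\nu)$, and let $W=(W(\underline{x}),\,\underline{x}\in\mathcal{D})$ be a Gaussian random field, independent of $l$, with pointwise mean $\mu_W(\underline{x})=\mathbb{E}(W(\underline{x}))$ and pointwise variance $\sigma_W(\underline{x})^2:=\mathrm{Var}(W(\underline{x}))$ for $\underline{x}\in\mathcal{D}$. Further, let $F:\mathbb{R}\to\mathbb{R}_+$ be measurable. Then for every $\underline{x}\in\mathcal{D}$ and every $\xi\in\mathbb{R}$, $$\phi_{l(F(W(\underline{x})))}(\xi)=\mathbb{E}\Big(\exp\big(i\xi\, l(F(W(\underline{x})))\big)\Big)=\frac{1}{\sqrt{2\pi\sigma_W(\underline{x})^2}}\int_{\mathbb{R}}\exp\Big(F(y)\psi(\xi)-\frac{(y-\mu_W(\underline{x}))^2}{2\sigma_W(\underline{x})^2}\Big)\,dy,$$ where $\psi$ denotes the characteristic exponent of $l$, defined by $$\psi(\xi)=i\gamma\xi-\frac{b}{2}\xi^2+\int_{\mathbb{R}\setminus\{0\}}\Big(e^{i\xi y}-1-i\xi y\,\mathbf{1}_{\{|y|\le 1\}}(y)\Big)\,\nu(dy),\quad \xi\in\mathbb{R}.$$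
   Context: All random objects live on a complete probability space $(\Omega,\mathcal{F},\mathbb{P})$; $\mathbb{R}_+=[0,\infty)$. A Lévy process $l$ on $[0,\infty)$ is a real-valued stochastic process with $l(0)=0$ a.s., independent and stationary increments, which is stochastically continuous; it is taken to have càdlàg paths. It has Lévy triplet $(\gamma,b,\nu)$, with $\gamma\in\mathbb{R}$, $b\ge 0$ and $\nu$ a measure on $\mathbb{R}$ with $\int_{\mathbb{R}}\min(y^2,1)\,\nu(dy)<\infty$, if $\mathbb{E}(\exp(i\xi l(t)))=\exp(t\psi(\xi))$ for all $t\ge0$, $\xi\in\mathbb{R}$, with $\psi$ as in the claim. A Gaussian random field $W$ on $\mathcal{D}$ is a family of real random variables indexed by $\mathcal{D}$ whose finite-dimensional distributions are multivariate Gaussian; $W:\Omega\times\mathcal{D}\to\mathbb{R}$ is assumed $\mathcal{F}\otimes\mathcal{B}(\mathcal{D})$-measurable. The field $L(\underline{x})=l(F(W(\underline{x})))$ is called the Gaussian subordinated Lévy field, and $\phi_X$ denotes the characteristic function of a random variable $X$. *)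

(* Defs.v *)
From HB Require Import structures.
From mathcomp Require Import all_boot all_order all_algebra.
From mathcomp Require Import all_classical all_reals all_analysis.
From mathcomp Require Export complex.
Import Order.TTheory GRing.Theory Num.Theory.
Import numFieldTopology.Exports numFieldNormedType.Exports.

Set Implicit Arguments.
Unset Strict Implicit.
Unset Printing Implicit Defensive.

Local Open Scope classical_set_scope.
Local Open Scope ring_scope.
Local Open Scope complex_scope.

Section ComplexValued.
Context {R : realType}.

Definition cexp (z : R[i]) : R[i] :=
  (expR (complex.Re z) * cos (complex.Im z)) +i*
  (expR (complex.Re z) * sin (complex.Im z)).

(* Each part takes the value 0 when its integral is not finite. *)
Definition cintegral {d : measure_display} {T : measurableType d}
    (mu : {measure set T -> \bar R}) (D : set T) (f : T -> R[i]) : R[i] :=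
  (\int[mu]_(x in D) complex.Re (f x)) +i*
  (\int[mu]_(x in D) complex.Im (f x)).

Definition char_fun {d : measure_display} {T : measurableType d}
    (P : probability T R) (X : T -> R) (xi : R) : R[i] :=
  cintegral P setT (fun w => cexp ('i * (xi * X w)%:C)).

End ComplexValued.

Section Processes.
Context {R : realType} {d : measure_display} {T : measurableType d}.
Variable P : probability T R.

(* Taking [B i = setT] for some indices gives the product rule for all
   subfamilies. *)
Definition mutually_independent (I : finType) (X : I -> T -> R) : Prop :=
  forall B : I -> set R, (forall i, measurable (B i)) ->
    P (\bigcap_i (X i @^-1` B i)) = (\prod_i P (X i @^-1` B i))%E.

Definition sigma_generated (I : Type) (J : set I) (X : I -> T -> R) :
    set (set T) :=
  <<s [set A | exists i B, [/\ J i, measurable B & A = X i @^-1` B] ] >>.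

Definition independent_processes (I1 I2 : Type) (J1 : set I1) (J2 : set I2)
    (X : I1 -> T -> R) (Y : I2 -> T -> R) : Prop :=
  forall A B, sigma_generated J1 X A -> sigma_generated J2 Y B ->
    P (A `&` B) = (P A * P B)%E.

(* A process on [0, +oo) is a family indexed by [R], whose members at negative
   times are never used. *)
Record levy_process (l : R -> {RV P >-> R}) : Prop := LevyProcess {
  levy_init : {ae P, forall w, l 0 w = 0};
  levy_indep_increments : forall (n : nat) (t : nat -> R),
    0 <= t 0%N -> (forall i, (i < n)%N -> t i < t i.+1) ->
    mutually_independent (fun (i : 'I_n) w => l (t i.+1) w - l (t i) w);
  levy_stationary_increments : forall s t h : R,
    0 <= s -> 0 <= t -> 0 <= h ->
    forall B : set R, measurable B ->
      P [set w | B (l (s + h) w - l s w)] =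
      P [set w | B (l (t + h) w - l t w)];
  levy_stochastic_continuity : forall t e : R, 0 <= t -> 0 < e ->
    P [set w | e < `|l s w - l t w|]
      @[s --> within [set s : R | 0 <= s] (nbhs t)] --> 0%E;
  levy_cadlag_right : forall (w : T) (t : R), 0 <= t ->
    l s w @[s --> t^'+] --> l t w;
  levy_cadlag_left : forall (w : T) (t : R), 0 < t ->
    cvg (l s w @[s --> t^'-]) }.

Definition levy_exponent (gamma b : R)
    (nu : {measure set R -> \bar R}) (xi : R) : R[i] :=
  'i * (gamma * xi)%:C - (b / 2 * xi ^+ 2)%:C
  + cintegral nu [set~ 0] (fun y =>
      cexp ('i * (xi * y)%:C) - 1
      - 'i * (xi * y * \1_[set z : R | `|z| <= 1] y)%:C).

Record levy_triplet (l : R -> {RV P >-> R}) (gamma b : R)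
    (nu : {measure set R -> \bar R}) : Prop := LevyTriplet {
  triplet_b_ge0 : 0 <= b;
  triplet_nu : (\int[nu]_y (Num.min (y ^+ 2) 1)%:E < +oo)%E;
  triplet_char_fun : forall t xi : R, 0 <= t ->
    char_fun P (l t) xi = cexp (t%:C * levy_exponent gamma b nu xi) }.

(* Point masses are Gaussian.  They are treated separately because
   [normal_prob m 0] is the uniform law on [0, 1]. *)
Definition gaussian_rv (X : T -> R) : Prop :=
  exists m s : R, forall B : set R, measurable B ->
    P (X @^-1` B) = if s == 0 then \d_m B else normal_prob m s B.

Definition gaussian_vector (n : nat) (X : 'I_n -> T -> R) : Prop :=
  forall a : 'I_n -> R, gaussian_rv (fun w => \sum_(i < n) a i * X i w).

Definition gaussian_field (k : nat) (D : set 'rV[R]_k)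
    (W : 'rV[R]_k -> {RV P >-> R}) : Prop :=
  forall (n : nat) (x : 'I_n -> 'rV[R]_k), (forall i, D (x i)) ->
    gaussian_vector (fun i => W (x i)).

Definition borel_on (k : nat) (D : set 'rV[R]_k) : set (set 'rV[R]_k) :=
  <<s D, [set D `&` U | U in open] >>.

(* The product sigma-algebra is taken on the carrier [setT `*` D], so that [D]
   need not be a Borel set. *)
Definition jointly_measurable (k : nat) (D : set 'rV[R]_k)
    (W : 'rV[R]_k -> T -> R) : Prop :=
  forall B : set R, measurable B ->
    <<s setT `*` D,
      [set C | exists A U, [/\ measurable A, borel_on D U & C = A `*` U] ] >>
    [set z : T * 'rV[R]_k | D z.2 /\ B (W z.2 z.1)].

End Processes.

(* Main.v *)
Require Import Defs.
From HB Require Import structures.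
From mathcomp Require Import all_boot all_order all_algebra.
From mathcomp Require Import all_classical all_reals all_analysis.
From mathcomp Require Import measurable_realfun ring lra.
Import Order.TTheory GRing.Theory Num.Theory.
Import numFieldTopology.Exports numFieldNormedType.Exports.

Local Open Scope classical_set_scope.
Local Open Scope ring_scope.
Local Open Scope complex_scope.

(**
For a fixed [t], independence of [W x] and [l] gives
[E (1_A (W x) * h (l t)) = P (W x \in A) * E (h (l t))].  Replacing the random
time [tau = F (W x)] by countably-valued times [tau_n > tau] converging to it,
and summing over the values of [tau_n], yields [E (h (l tau_n)) = E (H tau_n)]
where [H t = E (h (l t))].  The paths of [l] are right-continuous and [H] is
continuous, so dominated convergence gives [E (h (l tau)) = E (H tau)]; this
needs no joint measurability of [l].  With [h] the real and imaginary parts of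
[exp (i xi .)], [H] is read off the characteristic exponent, and
[E (H (F (W x)))] is an integral against a normal density, whose parameters are
identified with the given mean and variance by computing its first two moments.
*)

(** * Integration against a measure given by a density *)

Section density.
Context d (T : measurableType d) (R : realType).
Variables (mu : {sigma_finite_measure set T -> \bar R})
  (nu : {finite_measure set T -> \bar R}) (g : T -> R).
Hypothesis g_int : mu.-integrable setT (EFin \o g).
Hypothesis g_ge0 : forall x, 0 <= g x.
Hypothesis nu_density :
  forall A, measurable A -> nu A = (\int[mu]_(x in A) (g x)%:E)%E.

Let nu_mu : nu `<< mu.
Proof.
apply/null_content_dominatesP => A mA muA0; rewrite nu_density//.
apply: null_set_integral => //.
apply: measurable_funS (measurable_int _ g_int) => //.
Qed.

(** The Radon-Nikodym derivative of [nu] and [g] have the same integral over every measurable set,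
    hence agree almost everywhere, and the change of variables formula can be read with [g]. *)
Lemma ge0_integral_density (f : T -> \bar R) : (forall x, 0 <= f x)%E ->
  measurable_fun setT f -> (\int[nu]_x f x = \int[mu]_x (f x * (g x)%:E))%E.
Proof.
move=> f0 mf; rewrite -(Radon_Nikodym_SigmaFinite.change_of_variables nu_mu)//.
have mg := measurable_int _ g_int.
apply: ae_eq_integral => //.
- apply: emeasurable_funM => //.
  exact: measurable_int (Radon_Nikodym_SigmaFinite.f_integrable _).
- exact: emeasurable_funM.
- apply: ae_eqe_mul2l; apply: integral_ae_eq => //.
  + exact: Radon_Nikodym_SigmaFinite.f_integrable.
  + by move=> A _ mA; rewrite -Radon_Nikodym_SigmaFinite.f_integral// nu_density.
Qed.

(** Since [g] is nonnegative, multiplying by it commutes with taking positive and negative parts, so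
    the nonnegative case applies to each part. *)
Lemma integral_density (f : T -> \bar R) : measurable_fun setT f ->
  (\int[nu]_x f x = \int[mu]_x (f x * (g x)%:E))%E.
Proof.
move=> mf; rewrite [LHS]integralE [RHS]integralE.
congr (_ - _)%E; rewrite ge0_integral_density.
all: try exact: measurable_funepos.
all: try exact: measurable_funeneg.
all: try (by move=> x).
- by apply: eq_integral => x _; rewrite !funeposE maxe_pMl ?mul0e ?lee_fin.
- by apply: eq_integral => x _; rewrite !funenegE maxe_pMl ?mul0e ?lee_fin ?mulNe.
Qed.
End density.

(** * Integral of a derivative over the whole line *)

Section ftc_line.
Context (R : realType).
Notation mu := (@lebesgue_measure R).

(** On growing intervals centred at [m] the integral is a difference of boundary values of [F].
    These vanish in the limit because [F x] is at most [C / |x - m|] in absolute value, and the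
    truncated integrals converge by domination by [|f|]. *)
Lemma integralT_derivative_eq0 (F f : R -> R) (m C : R) :
  (forall x : R, is_derive x 1 F (f x)) -> continuous f ->
  mu.-integrable setT (EFin \o f) -> (forall x, `|(x - m) * F x| <= C) ->
  (\int[mu]_x (f x)%:E = 0)%E.
Proof.
move=> dF cf intf decay.
(* The radius [n.+1] keeps the interval nondegenerate and turns the decay bound into
   [C * harmonic n]. *)
pose I (n : nat) := `[m - n.+1%:R, m + n.+1%:R]%classic.
pose g n : R -> \bar R := (EFin \o f) \_ (I n).
have FTC n : (\int[mu]_x g n x =
    (F (m + n.+1%:R) - F (m - n.+1%:R))%:E)%E.
  have cF : continuous F.
    by move=> x; apply: differentiable_continuous; apply/derivable1_diffP; case: (dF x).
  rewrite -integral_mkcond (@continuous_FTC2 _ f F)//.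
  - have : 0 < n.+1%:R :> R by []. lra.
  - exact: continuous_subspaceT.
  - split.
    + by move=> x _; case: (dF x).
    + exact/cvg_at_right_filter/cF.
    + exact/cvg_at_left_filter/cF.
  - by move=> x _; rewrite derive1E; case: (dF x).
(* The sign [e] is [1] or [-1], which handles both endpoints at once. *)
have Fcvg e : `|e| = 1 -> F (m + e * n.+1%:R) @[n --> \oo] --> 0.
  move=> e1; apply/norm_cvg0P.
  apply: (@squeeze_cvgr _ _ _ _ (cst 0) (fun n => C * harmonic n)).
  - apply: nearW => n; rewrite normr_ge0/=; have := decay (m + e * n.+1%:R).
    rewrite addrAC subrr add0r !normrM e1 mul1r normr_nat mulrC.
    by rewrite ler_pdivlMr.
  - exact: cvg_cst.
  - by rewrite -[X in _ --> X](mulr0 C); apply: cvgMr; exact: cvg_harmonic.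
have F0 : F (m + n.+1%:R) - F (m - n.+1%:R) @[n --> \oo] --> 0.
  rewrite -[X in _ --> X]subr0; apply: cvgB.
    have := Fcvg 1 (normr1 _); under eq_fun do rewrite mul1r; exact.
  have := Fcvg (-1) (normrN1 _); under eq_fun do rewrite mulN1r; exact.
have : (\int[mu]_x g n x)%E @[n --> \oo] --> (\int[mu]_x (f x)%:E)%E.
  apply: (@dominated_cvg _ _ _ mu _ measurableT g
    (EFin \o f) (fun x => `|(f x)%:E|%E)) => //.
  - move=> n; apply/(measurable_restrictT _ _).1 => //.
      exact: measurable_itv.
    exact: measurable_funS (measurable_int _ intf).
  - move=> x _; apply: cvg_near_cst; near=> n.
    rewrite /g patchE ifT// inE /I/= in_itv/=.
    suff : `|x - m| <= n%:R by rewrite ler_norml -natr1; lra.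
    by near: n; exact: nbhs_infty_ger.
  - exact: integrable_abse intf.
  - by move=> n x _; rewrite /g patchE; case: ifP => // _; rewrite abse0.
under eq_fun do rewrite FTC.
move=> /cvg_lim <- //.
have /cvg_lim -> // : (F (m + n.+1%:R) - F (m - n.+1%:R))%:E @[n --> \oo] --> 0%:E.
by apply: cvg_EFin; [apply: nearW|exact: F0].
Unshelve. end_near. Qed.
End ftc_line.

(** * First two moments of the normal density *)

Section normal_moments.
Context (R : realType) (m s : R).
Hypothesis s_neq0 : s != 0.
Notation mu := (@lebesgue_measure R).
Local Notation pdf := (normal_pdf m s).
Local Notation s' := (Num.sqrt 2 * s).

Let s2_gt0 : 0 < s ^+ 2. Proof. by rewrite exprn_even_gt0. Qed.

Lemma is_derive_normal_pdf (x : R) :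
  is_derive x 1 pdf (- ((x - m) / s ^+ 2 * pdf x)).
Proof.
rewrite normal_pdfE// /normal_fun; apply: is_derive_eq.
by rewrite /GRing.scale/=; field.
Qed.

(* [y * expR (- 2 * y) <= expR (- y)] with [y = (x - m) ^+ 2 / (4 * s ^+ 2)]. *)
Lemma sqr_normal_fun_le x :
  (x - m) ^+ 2 * normal_fun m s x <= 4 * s ^+ 2 * normal_fun m s' x.
Proof.
rewrite /normal_fun.
pose y := (x - m) ^+ 2 / (4 * s ^+ 2).
have -> : - (x - m) ^+ 2 / (s ^+ 2 *+ 2) = - y + - y by rewrite /y; field.
have -> : - (x - m) ^+ 2 / (s' ^+ 2 *+ 2) = - y.
  by rewrite exprMn sqr_sqrtr// /y; field.
have -> : (x - m) ^+ 2 = 4 * s ^+ 2 * y by rewrite /y; field.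
rewrite expRD -[leLHS]mulrA ler_pM2l; last by apply: mulr_gt0.
rewrite mulrA ler_piMl ?expR_ge0//.
rewrite expRN ler_pdivrMr ?expR_gt0// mul1r.
by apply: le_trans (expR_ge1Dx _); rewrite lerDr.
Qed.

(** [K] is the factor in [sqr_normal_fun_le] times the peak of [pdf]. It gives both an integrable
    majorant and a uniform bound for [(x - m) ^+ 2 * pdf x]. *)
Let K := 4 * s ^+ 2 * normal_peak s.

Let K_ge0 : 0 <= K.
Proof. by rewrite /K mulr_ge0 ?normal_peak_ge0// mulr_ge0// ltW. Qed.

Let sqr_normal_pdf_le x : (x - m) ^+ 2 * pdf x <= K * normal_fun m s' x.
Proof.
rewrite normal_pdfE// mulrCA.
have -> : K * normal_fun m s' x = normal_peak s * (4 * s ^+ 2 * normal_fun m s' x).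
  by rewrite /K; ring.
by rewrite ler_wpM2l ?normal_peak_ge0// sqr_normal_fun_le.
Qed.

Let sqr_normal_pdf_le_cst x : (x - m) ^+ 2 * pdf x <= K.
Proof.
apply: (le_trans (sqr_normal_pdf_le x)); rewrite ler_piMr//.
rewrite /normal_fun -expR0 ler_expR mulNr oppr_le0.
by rewrite divr_ge0 ?sqr_ge0// mulrn_wge0// sqr_ge0.
Qed.

(** From [|u| <= 1 + u ^+ 2]: bounds on the first-moment integrand reduce to those on [pdf] and on
    the second-moment integrand. *)
Let lin_normal_pdf_le x : `|(x - m) * pdf x| <= pdf x + (x - m) ^+ 2 * pdf x.
Proof.
rewrite normrM (ger0_norm (normal_pdf_ge0 _ _ _)).
have -> : pdf x + (x - m) ^+ 2 * pdf x = (1 + (x - m) ^+ 2) * pdf x by ring.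
rewrite ler_wpM2r ?normal_pdf_ge0// -real_normK ?num_real//.
have := normr_ge0 (x - m); nra.
Qed.

Let s'_neq0 : s' != 0.
Proof. by rewrite mulf_neq0// gt_eqF// sqrtr_gt0. Qed.

Let mXm : measurable_fun setT (fun x : R => x - m).
Proof. exact: measurable_funB. Qed.

Lemma integrable_sqr_normal_pdf :
  mu.-integrable setT (fun x => ((x - m) ^+ 2 * pdf x)%:E).
Proof.
(* Dividing by the peak makes [K * normal_fun m s'] a multiple of the normal density with parameter
   [s']. *)
have := integrableZl measurableT (K / normal_peak s') (integrable_normal_pdf m s').
apply: le_integrable => //.
  apply/measurable_EFinP/measurable_funM; last exact: measurable_normal_pdf.
  exact: measurable_funX.
move=> x _; rewrite -EFinM !abse_EFin lee_fin.
rewrite ger0_norm; last by rewrite mulr_ge0 ?normal_pdf_ge0// sqr_ge0.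
apply: le_trans (ler_norm _).
rewrite (normal_pdfE m s'_neq0) mulrA divfK ?gt_eqF ?normal_peak_gt0//.
Qed.

Lemma integrable_lin_normal_pdf :
  mu.-integrable setT (fun x => ((x - m) * pdf x)%:E).
Proof.
have := integrableD measurableT (integrable_normal_pdf m s) integrable_sqr_normal_pdf.
apply: le_integrable => //.
  by apply/measurable_EFinP/measurable_funM => //; exact: measurable_normal_pdf.
move=> x _; rewrite /= lee_fin (le_trans (lin_normal_pdf_le x))//.
exact: ler_norm.
Qed.

Let cXm : continuous (fun x : R => x - m).
Proof. by move=> x; apply: cvgB; [exact: cvg_id|exact: cvg_cst]. Qed.

(** The integrand is the derivative of [- s ^+ 2 * pdf x]; the decay constant comes from
    [lin_normal_pdf_le] and the bounds [normal_peak s] and [K] on its two terms. *)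
Lemma integral_lin_normal_pdf : (\int[mu]_x ((x - m) * pdf x)%:E = 0)%E.
Proof.
apply: (@integralT_derivative_eq0 _ (fun x => - s ^+ 2 * pdf x) _ m
  (s ^+ 2 * (normal_peak s + K))).
- move=> x; have dpdf := is_derive_normal_pdf x; apply: is_derive_eq.
  by rewrite /GRing.scale/=; field.
- by move=> x; apply: cvgM; [exact: cXm|exact: continuous_normal_pdf].
- exact: integrable_lin_normal_pdf.
- move=> x; rewrite mulrCA normrM normrN (ger0_norm (ltW s2_gt0)) ler_pM2l//.
  by rewrite (le_trans (lin_normal_pdf_le x))// lerD// normal_pdf_ub.
Qed.

(** Integration by parts: [((x - m) ^+ 2 - s ^+ 2) * pdf x] is the derivative of
    [- s ^+ 2 * ((x - m) * pdf x)], and [pdf] has total mass 1. *)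
Lemma integral_sqr_normal_pdf :
  (\int[mu]_x ((x - m) ^+ 2 * pdf x)%:E = (s ^+ 2)%:E)%E.
Proof.
suff : (\int[mu]_x (((x - m) ^+ 2 - s ^+ 2) * pdf x)%:E = 0)%E.
  under eq_integral do rewrite mulrBl EFinB [X in (_ - X)%E]EFinM.
  rewrite integralB//; [|exact: integrable_sqr_normal_pdf|]; last first.
    by apply: integrableZl => //; exact: integrable_normal_pdf.
  rewrite integralZl//; last exact: integrable_normal_pdf.
  rewrite integral_normal_pdf mule1.
  rewrite -(fineK (integrable_fin_num measurableT integrable_sqr_normal_pdf)).
  by rewrite -EFinB => -[/subr0_eq ->].
apply: (@integralT_derivative_eq0 _ (fun x => - s ^+ 2 * ((x - m) * pdf x)) _ m
  (s ^+ 2 * K)).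
- move=> x; have dpdf := is_derive_normal_pdf x; apply: is_derive_eq.
  by rewrite /GRing.scale/=; field.
- move=> x; apply: cvgM; last exact: continuous_normal_pdf.
  apply: cvgB; last exact: cvg_cst.
  by rewrite expr2; under eq_fun do rewrite expr2; apply: cvgM; exact: cXm.
- have := integrableB measurableT integrable_sqr_normal_pdf
    (integrableZl measurableT (s ^+ 2) (integrable_normal_pdf m s)).
  by apply: eq_integrable => // x _; rewrite /= mulrBl EFinB.
- move=> x; rewrite mulrCA normrM normrN (ger0_norm (ltW s2_gt0)) ler_pM2l//.
  by rewrite mulrA -expr2 ger0_norm// mulr_ge0 ?normal_pdf_ge0// sqr_ge0.
Qed.

End normal_moments.

(** * Integrals and moments of a random variable with a given law *)

Section laws.
Context d (T : measurableType d) (R : realType) (P : probability T R).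

Lemma integral_law d' (T' : measurableType d') (X : {RV P >-> T'})
  (nu : {measure set T' -> \bar R}) (f : T' -> \bar R) :
  (forall B, measurable B -> P (X @^-1` B) = nu B) ->
  measurable_fun setT f -> (\int[P]_w f (X w) = \int[nu]_y f y)%E.
Proof.
move=> Xnu mf.
rewrite -(@eq_measure_integral _ _ _ setT nu (distribution P X)); last first.
  by move=> B mB _; exact: Xnu.
rewrite [LHS]integralE [RHS]integralE !ge0_integral_distribution//.
- by congr (_ - _)%E; apply: eq_integral => w _; rewrite /= ?funeposE ?funenegE.
- exact: measurable_funeneg.
- exact: measurable_funepos.
Qed.

Variables (X : {RV P >-> R}).

(** Serves to rule out the point-mass case of a Gaussian variable when the variance is positive. *)
Lemma variance_dirac_law (m : R) :
  (forall B, measurable B -> P (X @^-1` B) = \d_m B) -> ('V_P[X] = 0)%E.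
Proof.
move=> law.
have EX : ('E_P[X] = m%:E)%E.
  rewrite unlock (integral_law _ _ X (\d_m) EFin law)//.
  by rewrite integral_dirac// diracT mul1e.
rewrite /variance covariance.unlock EX/= expectation.unlock.
have mf : measurable_fun setT (fun y : R => ((y - m) * (y - m))%:E).
  by apply/measurable_EFinP/measurable_funM; exact: measurable_funB.
by rewrite (integral_law _ _ X (\d_m) _ law mf) integral_dirac// subrr mul0r mule0.
Qed.

Section normal_law.
Variables (m s : R).
Hypothesis s_neq0 : s != 0.
Hypothesis law : forall B, measurable B -> P (X @^-1` B) = normal_prob m s B.
Notation mu := (@lebesgue_measure R).
Local Notation pdf := (normal_pdf m s).

(** Stated for every measurable [f], so that applying it to [|f|] yields the integrability criterion
    [integrable_normal_law]. *)
Lemma integral_normal_law (f : R -> R) : measurable_fun setT f ->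
  (\int[P]_w (f (X w))%:E = \int[mu]_y (f y * pdf y)%:E)%E.
Proof.
move=> mf.
have mX : measurable_fun setT (X : T -> measurableTypeR R).
  by exact: (@measurable_funP _ _ T R setT X).
(* [lebesgue_measure] is a measure on [measurableTypeR R], whose canonical
   structures do not unify with those of the codomain of [X]. *)
pose X' : {mfun T >-> measurableTypeR R} :=
  @mfun_Sub _ _ T (measurableTypeR R) X (mem_set mX).
rewrite (integral_law _ _ X' (distribution P X') (EFin \o f))//;
  last exact/measurable_EFinP.
rewrite (integral_density _ _ _ mu (distribution P X') _ (integrable_normal_pdf m s))//.
- exact: normal_pdf_ge0.
- exact/measurable_EFinP.
Qed.

Lemma integrable_normal_law (f : R -> R) : measurable_fun setT f ->
  mu.-integrable setT (fun y => (f y * pdf y)%:E) ->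
  P.-integrable setT (fun w => (f (X w))%:E).
Proof.
move=> mf /integrableP[_ fi]; apply/integrableP; split.
  by apply/measurable_EFinP; apply: measurableT_comp.
have mnf : measurable_fun setT (fun y => `|f y|) by exact: measurableT_comp.
rewrite [X in (X < _)%E](integral_normal_law _ mnf).
under eq_integral do rewrite -(ger0_norm (normal_pdf_ge0 _ _ _)) -normrM.
exact: fi.
Qed.

Lemma expectation_normal_law : ('E_P[X] = m%:E)%E.
Proof.
have mf : measurable_fun setT (fun y : R => y - m) by exact: measurable_funB.
have := integral_normal_law _ mf; rewrite integral_lin_normal_pdf// => E0.
have iXm := integrable_normal_law _ mf (integrable_lin_normal_pdf _ m _ s_neq0).
rewrite unlock.
transitivity (\int[P]_w ((X w - m)%:E + m%:E))%E.
  by apply: eq_integral => w _; rewrite -EFinD subrK.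
rewrite integralD//; last exact: finite_measure_integrable_cst.
by rewrite E0 add0e integral_cst//= probability_setT mule1.
Qed.

Lemma variance_normal_law : ('V_P[X] = (s ^+ 2)%:E)%E.
Proof.
rewrite /variance covariance.unlock expectation_normal_law/= expectation.unlock.
rewrite -(integral_sqr_normal_pdf _ m _ s_neq0) -integral_normal_law//.
by apply: measurable_funX; exact: measurable_funB.
Qed.
End normal_law.
End laws.

(** * Factorization of integrals over an independent event *)

Section independent_integral.
Context d (T : measurableType d) (R : realType) (P : probability T R).
Variables (X : {RV P >-> R}) (A : set T).
Hypothesis mA : measurable A.
Hypothesis indep :
  forall B, measurable B -> P (A `&` X @^-1` B) = (P A * P (X @^-1` B))%E.

(** Restrict [P] to [A] and push it forward by [X]: by independence the result is the law of [X]
    scaled by [P A]. *)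
Lemma ge0_integral_indep (f : R -> \bar R) : measurable_fun setT f ->
  (forall y, 0 <= f y)%E ->
  (\int[P]_(w in A) f (X w) = P A * \int[P]_w f (X w))%E.
Proof.
move=> mf f0; pose PA := mrestr P mA.
have mfX : measurable_fun setT (f \o X) by exact: measurableT_comp.
have PA0 : (0 <= fine (P A)) by rewrite fine_ge0.
transitivity (\int[PA]_w f (X w))%E.
  rewrite -[in RHS](setUv A) ge0_integral_setU//; last 3 first.
  - exact: measurableC.
  - by rewrite setUv.
  - exact/disj_setPCl.
  rewrite [X in (_ + X)%E]null_set_integral ?adde0.
  - apply: eq_measure_integral => B mB BA.
    by rewrite /PA /= /mrestr setIidl.
  - exact: measurableC.
  - exact: measurable_funS mfX.
  - by rewrite /PA/= /mrestr setICl measure0.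
transitivity (\int[pushforward PA X]_y f y)%E.
  by rewrite ge0_integral_pushforward.
transitivity (\int[mscale (NngNum PA0) (distribution P X)]_y f y)%E.
  apply: eq_measure_integral => B mB _.
  rewrite /PA/= /pushforward/= /mrestr /mscale/= setIC indep//.
  by rewrite fineK ?fin_num_measure.
rewrite ge0_integral_mscale//= fineK ?fin_num_measure//.
by rewrite ge0_integral_distribution.
Qed.

Lemma integral_indep (f : R -> \bar R) : measurable_fun setT f ->
  P.-integrable setT (f \o X) ->
  (\int[P]_(w in A) (f \o X) w = P A * \int[P]_w (f \o X) w)%E.
Proof.
move=> mf fi; rewrite [LHS]integralE [in RHS]integralE.
rewrite muleBr ?fin_num_measure ?integrable_add_def//.
rewrite funepos_comp funeneg_comp !ge0_integral_indep//.
- exact: measurable_funeneg.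
- exact: measurable_funepos.
Qed.
End independent_integral.

(** * Bounded random variables *)

Section bounded_random_variables.
Context d (T : measurableType d) (R : realType) (P : probability T R).
Variables (f : T -> R) (M : R).
Hypothesis mf : measurable_fun setT f.
Hypothesis fM : forall w, `|f w| <= M.

Lemma integrable_bounded : P.-integrable setT (EFin \o f).
Proof.
apply: le_integrable (finite_measure_integrable_cst P M measurableT) => //.
  exact/measurable_EFinP.
by move=> w _; rewrite /= lee_fin (le_trans (fM w))// ler_norm.
Qed.

Lemma norm_integral_bounded : (`|\int[P]_w (f w)%:E| <= M%:E)%E.
Proof.
have mf' : measurable_fun setT (EFin \o f) by exact/measurable_EFinP.
apply: (le_trans (le_abse_integral _ _ _)) => //.
apply: (le_trans (integral_le_bound M%:E _ _ _ _)) => //.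
- by rewrite lee_fin (le_trans _ (fM point)).
- by apply: aeW => w _; rewrite /= lee_fin.
- by rewrite [X in (_ * X)%E]probability_setT mule1.
Qed.
End bounded_random_variables.

(** * Sampling a process at an independent random time *)

Section random_time_sampling.
Context d (T : measurableType d) (R : realType) (P : probability T R).
Variables (X : R -> {RV P >-> R}) (tau : T -> R) (h H : R -> R) (M : R).
Hypothesis mtau : measurable_fun setT tau.
Hypothesis tau_ge0 : forall w, 0 <= tau w.
Hypothesis indep : forall (t : R) (A B : set R), 0 <= t ->
  measurable A -> measurable B ->
  P (tau @^-1` A `&` X t @^-1` B) = (P (tau @^-1` A) * P (X t @^-1` B))%E.
Hypothesis X_right : forall w (t : R), 0 <= t -> X s w @[s --> t^'+] --> X t w.
Hypothesis ch : continuous h.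
Hypothesis h_bound : forall y, `|h y| <= M.
Hypothesis cH : continuous H.
Hypothesis HE : forall t : R, 0 <= t -> (\int[P]_w (h (X t w))%:E = (H t)%:E)%E.

(* Strictly above [tau], so that the right limits along [t^'+] apply. *)
Let tn n w : R := (Num.trunc (n.+1%:R * tau w)).+1%:R / n.+1%:R.

(** As the preimage of an interval under [tau], this event is measurable and independent of each
    [X t] with [t >= 0]; by [AP], [tn n] is constant on it. *)
Let A n k := tau @^-1` `[k%:R / n.+1%:R, k.+1%:R / n.+1%:R[.

Let AP n k w : A n k w <-> Num.trunc (n.+1%:R * tau w) = k.
Proof.
rewrite /A/= in_itv/= ler_pdivrMr// ltr_pdivlMr// ![tau w * _]mulrC.
rewrite -truncn_eq; last by rewrite mulr_ge0.
by split=> /eqP.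
Qed.

Let tn_gt n w : tau w < tn n w.
Proof. by rewrite /tn ltr_pdivlMr// mulrC truncnS_gt. Qed.

Let tn_ge0 n w : 0 <= tn n w.
Proof. exact: le_trans (tau_ge0 w) (ltW (tn_gt n w)). Qed.

Let tn_cvg w : tn n w @[n --> \oo] --> tau w.
Proof.
apply: (@squeeze_cvgr _ _ _ _ (cst (tau w)) (fun n => tau w + harmonic n)).
- apply: nearW => n; rewrite (ltW (tn_gt n w))/= /tn.
  rewrite ler_pdivrMr// mulrDl mulVf// -natr1 lerD2r mulrC truncn_le.
  by rewrite mulr_ge0.
- exact: cvg_cst.
- rewrite -[X in _ --> X]addr0; apply: cvgD; first exact: cvg_cst.
  exact: cvg_harmonic.
Qed.

Let tn_cvg_right (f : R -> R) w : f s @[s --> (tau w)^'+] --> f (tau w) ->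
  f (tn n w) @[n --> \oo] --> f (tau w).
Proof. by move/cvg_at_rightP; apply. Qed.

Let mA n k : measurable (A n k).
Proof. by rewrite /A -[X in measurable X]setTI; exact: mtau. Qed.

Let bigcupA n : \bigcup_k A n k = setT.
Proof.
by apply/seteqP; split => // w _; exists (Num.trunc (n.+1%:R * tau w)) => //; exact/AP.
Qed.

Let trivA n : trivIset setT (A n).
Proof. by move=> i j _ _ [w [/AP <- /AP <-]]. Qed.

(** On [A n k] the sampled function is [Y] at one fixed time, and countably many measurable pieces
    glue together. *)
Let measurable_sampled n (Y : R -> T -> R) : (forall t, measurable_fun setT (Y t)) ->
  measurable_fun setT (fun w => Y (tn n w) w).
Proof.
move=> mY; rewrite -(bigcupA n); apply/measurable_fun_bigcup => // k.
apply: (eq_measurable_fun (Y (k.+1%:R / n.+1%:R))).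
  by move=> w /[!inE] /AP <-.
exact: measurable_funS (mY _).
Qed.

Let mh : measurable_fun setT h := continuous_measurable_fun ch.
Let mH : measurable_fun setT H := continuous_measurable_fun cH.

Let mhX t : measurable_fun setT (fun w => h (X t w)).
Proof. exact: measurableT_comp. Qed.

Let H_bound (t : R) : 0 <= t -> `|H t| <= M.
Proof.
move=> t0; rewrite -lee_fin -abse_EFin -HE//.
exact: norm_integral_bounded.
Qed.

(** Summing over [k]: on [A n k] the sampling time is a constant [t], so independence gives
    [P (A n k)] times the mean of [h (X t)], which is [H t]. Boundedness by [M] justifies splitting
    the integrals. *)
Let integral_sampled n :
  (\int[P]_w (h (X (tn n w) w))%:E = \int[P]_w (H (tn n w))%:E)%E.
Proof.
rewrite -(bigcupA n) !integral_bigcup//.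
- apply: eq_eseriesr => k _.
  pose t : R := k.+1%:R / n.+1%:R.
  have tE w : A n k w -> tn n w = t by move=> /AP; rewrite /tn => ->.
  have t0 : 0 <= t by rewrite divr_ge0.
  transitivity (\int[P]_(w in A n k) ((EFin \o h) \o X t) w)%E.
    by apply: eq_integral => w /[!inE] /tE ->.
  rewrite integral_indep//.
  + under [RHS]eq_integral => w /[!inE] /tE -> do over.
    by rewrite [X in (_ * X)%E]HE// integral_cst// muleC.
  + by move=> B mB; apply: indep.
  + exact/measurable_EFinP.
  + by apply: (integrable_bounded _ _ _ _ _ M) => // w.
- rewrite bigcupA; apply: (integrable_bounded _ _ _ _ _ M) => //.
    exact: (measurable_sampled n (fun t w => H t)).
  by move=> w; exact: H_bound.
- rewrite bigcupA; apply: (integrable_bounded _ _ _ _ _ M) => //.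
  exact: (measurable_sampled n (fun t w => h (X t w))).
Qed.

Lemma integral_random_time :
  (\int[P]_w (h (X (tau w) w))%:E = \int[P]_w (H (tau w))%:E)%E.
Proof.
(* Bounded convergence: the constant [M] is integrable for a probability measure. *)
have dom (f_ : nat -> T -> R) f : (forall n, measurable_fun setT (f_ n)) ->
    (forall n w, `|f_ n w| <= M) -> (forall w, f_ n w @[n --> \oo] --> f w) ->
    (\int[P]_w (f_ n w)%:E @[n --> \oo] --> \int[P]_w (f w)%:E)%E.
  move=> mf fM fcvg.
  apply: (@dominated_cvg _ _ _ P _ measurableT
    (fun n w => (f_ n w)%:E) (EFin \o f) (cst M%:E)) => //.
  - by move=> n; exact/measurable_EFinP.
  - by move=> w _; apply: cvg_EFin; [exact: nearW|exact: fcvg].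
  - exact: finite_measure_integrable_cst.
  - by move=> n w _; rewrite /= lee_fin.
(* Only right limits of the paths are available here, whereas [c2] uses two-sided continuity of
   [H]. *)
have c1 : (\int[P]_w (h (X (tn n w) w))%:E @[n --> \oo] -->
    \int[P]_w (h (X (tau w) w))%:E)%E.
  apply: dom => //.
  - by move=> n; exact: (measurable_sampled n (fun t w => h (X t w))).
  - move=> w; apply: (tn_cvg_right (fun t => h (X t w))).
    by apply: continuous_cvg; [exact: ch|exact: X_right].
have c2 : (\int[P]_w (H (tn n w))%:E @[n --> \oo] -->
    \int[P]_w (H (tau w))%:E)%E.
  apply: dom => //.
  - by move=> n; exact: (measurable_sampled n (fun t w => H t)).
  - by move=> n w; exact: H_bound.
  - by move=> w; apply: continuous_cvg; [exact: cH|exact: tn_cvg].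
move: c1; under eq_fun do rewrite integral_sampled.
by move/cvg_lim => <- //; apply/cvg_lim.
Qed.

End random_time_sampling.

(** * Real and imaginary parts of the complex exponentials involved *)

Lemma cexp_imaginary (R : realType) (r : R) : cexp ('i * r%:C) = cos r +i* sin r.
Proof. by rewrite /cexp /=; simpc; rewrite expR0 !mul1r. Qed.

Lemma cexp_real_mul (R : realType) (t : R) (z : R[i]) :
  cexp (t%:C * z) = (expR (t * complex.Re z) * cos (t * complex.Im z)) +i*
                    (expR (t * complex.Re z) * sin (t * complex.Im z)).
Proof. by case: z => a b; rewrite /cexp; simpc. Qed.

Lemma cexp_real_mul_sub (R : realType) (t q : R) (z : R[i]) :
  cexp (t%:C * z - q%:C) =
  (expR (- q) * (expR (t * complex.Re z) * cos (t * complex.Im z))) +i*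
  (expR (- q) * (expR (t * complex.Re z) * sin (t * complex.Im z))).
Proof.
case: z => a b; rewrite /cexp; simpc => /=.
by rewrite expRD; congr (_ +i* _); ring.
Qed.

(** * Random times that are functions of a normal variable *)

Section normal_random_time.
Context d (T : measurableType d) (R : realType) (P : probability T R).
Variables (X : R -> {RV P >-> R}) (Y : {RV P >-> R}) (m s : R) (F : R -> R).
Hypothesis s_neq0 : s != 0.
Hypothesis law : forall B, measurable B -> P (Y @^-1` B) = normal_prob m s B.
Hypothesis mF : measurable_fun setT F.
Hypothesis F_ge0 : forall y, 0 <= F y.
Hypothesis indep : forall (t : R) (A B : set R), 0 <= t ->
  measurable A -> measurable B ->
  P (Y @^-1` A `&` X t @^-1` B) = (P (Y @^-1` A) * P (X t @^-1` B))%E.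
Hypothesis X_right : forall w (t : R), 0 <= t -> X s w @[s --> t^'+] --> X t w.

Lemma Rintegral_normal_random_time (h H : R -> R) (M : R) :
  continuous h -> (forall y, `|h y| <= M) -> continuous H ->
  (forall t : R, 0 <= t -> \int[P]_w h (X t w) = H t) ->
  \int[P]_w h (X (F (Y w)) w) =
  normal_peak s * \int[lebesgue_measure]_y (normal_fun m s y * H (F y)).
Proof.
move=> ch hM cH HE.
have mhX t : measurable_fun setT (fun w => h (X t w)).
  by apply: measurableT_comp => //; exact: continuous_measurable_fun.
have HE' (t : R) : 0 <= t -> (\int[P]_w (h (X t w))%:E = (H t)%:E)%E.
  (* The real-valued integral is the [fine] part of the extended one; boundedness of [h] makes the
     latter finite, so nothing is lost. *)
  move=> t0; rewrite -HE// /Rintegral fineK// integrable_fin_num//.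
  exact: (integrable_bounded _ _ _ _ _ M).
have H_bound (t : R) : 0 <= t -> `|H t| <= M.
  by move=> t0; rewrite -lee_fin -abse_EFin -HE'//; exact: norm_integral_bounded.
have mHF : measurable_fun setT (fun y => H (F y)).
  by apply: measurableT_comp => //; exact: continuous_measurable_fun.
have mFY : measurable_fun setT (fun w => F (Y w)) by exact: measurableT_comp.
rewrite /Rintegral (integral_random_time _ _ _ P X (fun w => F (Y w))
  h H M)//; last first.
  (* Independence passes from [Y] to [F (Y w)], whose events are events of [Y]. *)
  move=> t A B t0 mA mB; rewrite (_ : _ @^-1` A = Y @^-1` (F @^-1` A))//.
  by rewrite indep// -[F @^-1` A]setTI; exact: mF.
rewrite (integral_normal_law _ _ _ P Y m s law (fun y => H (F y)))//.
rewrite -/(Rintegral _ _ _) -RintegralZl//.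
  by apply: eq_Rintegral => y _; rewrite normal_pdfE// mulrC mulrA.
(* Pulling the peak out of the integral requires integrability: [|H (F y)| <= M], and dividing by
   the peak relates [normal_fun] to the density. *)
have := integrableZl measurableT (M / normal_peak s) (integrable_normal_pdf m s).
apply: le_integrable => //.
  apply/measurable_EFinP/measurable_funM; last exact: mHF.
  exact: measurable_normal_fun.
move=> y _; rewrite -EFinM !abse_EFin lee_fin normal_pdfE// mulrA.
rewrite divfK ?gt_eqF ?normal_peak_gt0// !normrM mulrC ler_wpM2r//.
by rewrite (le_trans _ (ler_norm _))// H_bound.
Qed.
End normal_random_time.

(** * Characteristic function of the subordinated field *)

Theorem corollary4p3 (R : realType) (dsp : measure_display)
  (Omega : measurableType dsp) (P : probability Omega R)
  (Pcomplete : measure_is_complete P)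
  (d : nat) (D : set 'rV[R]_d)
  (l : R -> {RV P >-> R}) (gamma b : R)
  (nu : {measure set R -> \bar R})
  (l_levy : levy_process l) (l_triplet : levy_triplet l gamma b nu)
  (W : 'rV[R]_d -> {RV P >-> R})
  (W_gaussian : gaussian_field D W) (W_meas : jointly_measurable D W)
  (W_l_indep : independent_processes P D [set t : R | 0 <= t] W l)
  (muW sigmaW : 'rV[R]_d -> R)
  (W_mean : forall x, D x -> ('E_P[W x] = (muW x)%:E)%E)
  (W_var : forall x, D x -> ('V_P[W x] = (sigmaW x ^+ 2)%:E)%E)
  (F : R -> R) (F_meas : measurable_fun setT F) (F_ge0 : forall y, 0 <= F y) :
  forall x, D x -> 0 < sigmaW x ^+ 2 -> forall xi : R,
    char_fun P (fun w => l (F (W x w)) w) xi =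
    ((Num.sqrt (2 * pi * sigmaW x ^+ 2))^-1)%:C *
    cintegral lebesgue_measure setT (fun y : R =>
      cexp ((F y)%:C * levy_exponent gamma b nu xi
            - ((y - muW x) ^+ 2 / (2 * sigmaW x ^+ 2))%:C)).
Proof.
move=> x Dx sigma_gt0 xi.
(* The variance determines [s] only up to sign, so [s] is kept apart from [sigmaW x] and only the
   squares are identified. *)
have [s [s_neq0 s2 law]] : exists s, [/\ s != 0, s ^+ 2 = sigmaW x ^+ 2 &
    forall B, measurable B -> P (W x @^-1` B) = normal_prob (muW x) s B].
  (* A one-point family with coefficient 1 extracts the marginal law of [W x]. *)
  have [m [s]] := W_gaussian 1%N (fun=> x) (fun=> Dx) (fun=> 1).
  under eq_fun do rewrite big_ord1 mul1r.
  have [_ law|s_neq0 law] := eqVneq s 0.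
    have := variance_dirac_law _ _ _ P (W x) m law.
    by rewrite (W_var _ Dx) => -[sigma0]; rewrite sigma0 ltxx in sigma_gt0.
  have := expectation_normal_law _ _ _ P (W x) m s s_neq0 law.
  rewrite (W_mean _ Dx) => -[mE].
  have := variance_normal_law _ _ _ P (W x) m s s_neq0 law.
  by rewrite (W_var _ Dx) => -[sE]; exists s; split; rewrite ?sE ?mE.
set psi := levy_exponent gamma b nu xi.
have indep (t : R) (A B : set R) : 0 <= t -> measurable A -> measurable B ->
    P (W x @^-1` A `&` l t @^-1` B) = (P (W x @^-1` A) * P (l t @^-1` B))%E.
  (* Events at a single point or a single time belong to the generators of the two
     sigma-algebras. *)
  move=> t0 mA mB; apply: W_l_indep; apply: sub_gen_smallest.
  - by exists x, A.
  - by exists t, B.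
have sampled := Rintegral_normal_random_time _ _ _ P l (W x) (muW x) s F
  s_neq0 law F_meas F_ge0 indep (levy_cadlag_right l_levy).
have peakE : normal_peak s = (Num.sqrt (2 * pi * sigmaW x ^+ 2))^-1.
  by rewrite /normal_peak s2; congr (Num.sqrt _)^-1; ring.
have funE y : expR (- ((y - muW x) ^+ 2 / (2 * sigmaW x ^+ 2))) =
    normal_fun (muW x) s y.
  by rewrite /normal_fun s2; congr expR; rewrite mulNr mulr_natl.
rewrite /char_fun /cintegral.
under [X in X +i* _]eq_Rintegral do rewrite cexp_imaginary/=.
under [X in _ +i* X]eq_Rintegral do rewrite cexp_imaginary/=.
(* The real and imaginary parts of the characteristic function of [l t] supply the functions [H] for
   [h = cos (xi .)] and [h = sin (xi .)]. *)
have HE t : 0 <= t -> 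
   \int[P]_w cos (xi * l t w) = expR (t * complex.Re psi) * cos (t * complex.Im psi) /\
   \int[P]_w sin (xi * l t w) = expR (t * complex.Re psi) * sin (t * complex.Im psi).
  move=> t0; have := triplet_char_fun l_triplet xi t0.
  rewrite /char_fun /cintegral.
  under [X in X +i* _]eq_Rintegral do rewrite cexp_imaginary/=.
  under [X in _ +i* X]eq_Rintegral do rewrite cexp_imaginary/=.
  by rewrite cexp_real_mul => -[].
(* From here on [psi] is just a complex number satisfying [HE]. *)
clearbody psi; rewrite -peakE.
have cxi : continuous (fun y : R => xi * y).
  by move=> y; apply: cvgM; [exact: cvg_cst|exact: cvg_id].
have cscale (r : R) : continuous (fun t : R => t * r).
  by move=> t; apply: cvgM; [exact: cvg_id|exact: cvg_cst].
rewrite (sampled (fun y => cos (xi * y))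
  (fun t => expR (t * complex.Re psi) * cos (t * complex.Im psi)) 1); first last.
- by move=> t /HE[].
- move=> t; apply: cvgM; apply: continuous_comp;
    [exact: cscale|exact: continuous_expR|exact: cscale|exact: continuous_cos].
- by move=> y; rewrite ler_norml cos_geN1 cos_le1.
- move=> y; apply: continuous_comp; [exact: cxi|exact: continuous_cos].
rewrite (sampled (fun y => sin (xi * y))
  (fun t => expR (t * complex.Re psi) * sin (t * complex.Im psi)) 1); first last.
- by move=> t /HE[].
- move=> t; apply: cvgM; apply: continuous_comp;
    [exact: cscale|exact: continuous_expR|exact: cscale|exact: continuous_sin].
- by move=> y; rewrite ler_norml sin_geN1 sin_le1.
- move=> y; apply: continuous_comp; [exact: cxi|exact: continuous_sin].
under [in RHS]eq_Rintegral do rewrite cexp_real_mul_sub funE/=.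
under [X in _ = _ * (_ +i* X)]eq_Rintegral do rewrite cexp_real_mul_sub funE/=.
by simpc.
Qed.
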